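(* Let $E$ be a separable Banach space, let $F$ be a bounded subset of its dual $E^*$, and let $f \in \overline{\operatorname{co}}^{w^*}(F)$. Then there is a sequence $(f_n)_{n\ge1}$ in $F$ such that $\frac{f_1 + \dots + f_N}{N} \to f$ in the weak$^*$ topology of $E^*$ as $N \to \infty$.
   Context: Banach spaces are real. $\overline{\operatorname{co}}^{w^*}(F)$ is the closure of the convex hull of $F$ in the weak$^*$ topology of $E^*$. *)

(* Defs.v *)
From HB Require Import structures.
From mathcomp Require Import all_boot all_order all_algebra.
From mathcomp Require Import all_classical all_reals all_analysis.

Set Implicit Arguments.
Unset Strict Implicit.
Unset Printing Implicit Defensive.

Import Order.TTheory GRing.Theory Num.Theory.
Import numFieldNormedType.Exports.

Local Open Scope classical_set_scope.
Local Open Scope ring_scope.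

Definition separable_space (T : topologicalType) : Prop :=
  exists2 D : set T, countable D & dense D.

Definition convex_hull (R : realType) (V : lmodType R) (A : set V) : set V :=
  smallest (@convex_set R V) A.

Section dual_space.
Context (R : realType) (E : normedModType R).

Definition continuous_linear_form : {pred (E -> R^o)} :=
  [pred f | `[< linear f /\ continuous f >]].

Record dual : predArgType := Dual {
  dual_fun :> E -> R^o ;
  _ : dual_fun \in continuous_linear_form }.

HB.instance Definition _ := [isSub for dual_fun].
HB.instance Definition _ := [Choice of dual by <:].

Let continuous_linear_form_closed : submod_closed continuous_linear_form.
Proof.
split.
  apply/asboolP; split=> [a x y|]; last exact: cst_continuous.
  by rewrite scaler0 addr0.
move=> k f g /asboolP[lf cf] /asboolP[lg cg]; apply/asboolP; split.
  have fgE z : (k *: f + g) z = k *: f z + g z by [].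
  by move=> a x y; rewrite !fgE lf lg !scalerDr !scalerA [a * k]mulrC addrACA.
by move=> x; apply: cvgD; [apply: cvgZr; exact: cf|exact: cg].
Qed.

HB.instance Definition _ := GRing.isSubmodClosed.Build R (E -> R^o)
  continuous_linear_form continuous_linear_form_closed.
HB.instance Definition _ := [SubChoice_isSubLmodule of dual by <:].

Lemma dual_linear (f : dual) : linear (f : E -> R^o).
Proof. by case: f => f /= /asboolP[]. Qed.

HB.instance Definition _ (f : dual) :=
  GRing.isLinear.Build R E R^o *:%R (f : E -> R^o) (dual_linear f).

Lemma dual_continuous (f : dual) : continuous (f : E -> R^o).
Proof. by case: f => f /= /asboolP[]. Qed.

Lemma dualP (f g : dual) : (forall x, f x = g x) -> f = g.
Proof. by move=> fg; apply/val_inj/funext. Qed.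

Lemma dualDE (f g : dual) x : (f + g) x = f x + g x.
Proof. by []. Qed.

Lemma dualZE (k : R) (f : dual) x : (k *: f) x = k * f x.
Proof. by []. Qed.

Definition dual_norm (f : dual) : R :=
  sup [set `|f x| | x in [set x | `|x| <= 1]].

Let dual_norm_nonempty (f : dual) :
  [set `|f x| | x in [set x | `|x| <= 1]] !=set0.
Proof. by exists `|f 0|, 0 => //=; rewrite normr0. Qed.

Let dual_norm_has_ubound (f : dual) :
  has_ubound [set `|f x| | x in [set x | `|x| <= 1]].
Proof.
have /linear_bounded_continuous/linear_boundedP/pinfty_ex_gt0[r r0 fr] :=
  @dual_continuous f.
exists r => _ [x /= x1 <-]; rewrite (le_trans (fr x))//.
by rewrite -[leRHS]mulr1 ler_wpM2l// ltW.
Qed.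

Lemma ler_dual_norm (f : dual) (x : E) : `|x| <= 1 -> `|f x| <= dual_norm f.
Proof. by move=> x1; apply: ub_le_sup => //; exists x. Qed.

Lemma dual_norm_ler (f : dual) (M : R) :
  (forall x, `|x| <= 1 -> `|f x| <= M) -> dual_norm f <= M.
Proof. by move=> fM; apply: ge_sup => // _ [x /= /fM + <-]. Qed.

Lemma dual_norm_ge0 (f : dual) : 0 <= dual_norm f.
Proof. by rewrite (le_trans (normr_ge0 (f 0)))// ler_dual_norm// normr0. Qed.

Let dual_normD (f g : dual) : dual_norm (f + g) <= dual_norm f + dual_norm g.
Proof.
apply: dual_norm_ler => x x1; rewrite dualDE.
by rewrite (le_trans (ler_normD _ _))// lerD// ler_dual_norm.
Qed.

Let dual_normZ_le (k : R) (f : dual) : dual_norm (k *: f) <= `|k| * dual_norm f.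
Proof.
apply: dual_norm_ler => x x1; rewrite dualZE normrM.
by rewrite ler_wpM2l// ler_dual_norm.
Qed.

Let dual_normZ (k : R) (f : dual) : dual_norm (k *: f) = `|k| * dual_norm f.
Proof.
apply/eqP; rewrite eq_le dual_normZ_le/=.
have [->|k0] := eqVneq k 0; first by rewrite normr0 mul0r dual_norm_ge0.
rewrite -ler_pdivlMl ?normr_gt0// -normfV.
by rewrite -[in leLHS](scalerK k0 f) dual_normZ_le.
Qed.

Let dual_norm0_eq0 (f : dual) : dual_norm f = 0 -> f = 0.
Proof.
move=> f0; apply: dualP => x.
have [->|x0] := eqVneq x 0; first by rewrite linear0.
have nx0 : `|x| != 0 by rewrite normr_eq0.
have : `|f (`|x|^-1 *: x)| <= 0.
  by rewrite -f0 ler_dual_norm// normrZ normfV normr_id mulVf.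
by rewrite normr_le0 linearZ scaler_eq0 invr_eq0 (negbTE nx0) => /eqP.
Qed.

HB.instance Definition _ := Lmodule_isNormed.Build R dual
  dual_normD dual_normZ dual_norm0_eq0.

Lemma dual_normE (f : dual) : `|f| = dual_norm f.
Proof. by []. Qed.

(* [dual] itself carries the norm topology; this alias of it carries the weak*
   topology, induced by the product topology on functions from E to R. *)
Definition weak_star : Type :=
  initial_topology (fun f : dual => (f : E -> R^o) : {ptws E -> R^o}).

HB.instance Definition _ := Topological.on weak_star.

Definition weak_star_closure (A : set dual) : set dual :=
  closure (A : set weak_star).

Definition weak_star_cvg (u : nat -> dual) (f : dual) : Prop :=
  (u N : weak_star) @[N --> \oo] --> (f : weak_star).

Lemma weak_star_cvgP (G : set_system dual) (f : dual) : Filter G ->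
  G --> (f : weak_star) <->
  (forall x : E, (h x : R^o) @[h --> G] --> (f x : R^o)).
Proof.
move=> FG; pose ev (h : weak_star) : {ptws E -> R^o} := (h : dual) : E -> R^o.
have -> : G --> (f : weak_star) <-> ev @ G --> ev f.
  split=> [Gf|evGf A /= [_ [[B oB <-] Bf BA]]].
    by apply: cvg_trans (cvg_app ev Gf) _; exact: initial_continuous.
  by apply: filterS BA _; apply: evGf; exact: open_nbhs_nbhs.
by split=> [/pointwise_cvgP|Gf]; [|apply/pointwise_cvgP]; exact.
Qed.

End dual_space.

(* Main.v *)
Require Import Defs.
From mathcomp Require Import all_boot all_order all_algebra.
From mathcomp Require Import all_classical all_reals all_analysis.
From mathcomp Require Import ring lra.
Import Order.TTheory GRing.Theory Num.Theory.
Import numFieldNormedType.Exports.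
Local Open Scope classical_set_scope.
Local Open Scope ring_scope.

(** The averages are produced greedily, with an energy estimate as in a
    Hilbert space.  Scale a dense sequence of E to a sequence e with
    |e k| <= 2^-k.  Then h |-> sum_k (h (e k))^2 is the square of a Hilbertian
    seminorm on the dual, controlled by the dual norm.

    Write S_n = (f_1 - f) + ... + (f_n - f).  Adding d = f_(n+1) - f changes the
    energy by the cross term 2 * sum_k S_n(e k) * d(e k) and by the energy of d,
    which is bounded because F is.  The cross term is 2 * d(v) for the
    vector v = sum_k S_n(e k) e_k of E.  Since f lies in the weak* closure of
    the convex hull of F, no half-space {g | g v >= r} with r > f v contains F,
    so f_(n+1) can be chosen in F with d(v) <= 1
    ([exists_lt_weak_star_closure]).  Hence the energy of S_n is O(n), and for
    each k the number S_n(e k) / n is O(n^(-1/2)) ([cvg_mean0_of_energy]).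
    The averages therefore converge to f on the dense sequence and, being
    bounded in norm, at every point of E ([weak_star_cvg_dense]).

    To stay with finite sums, the energy of S_n only uses the first n vectors
    e k.  The coordinate that enters at step n costs
    S_n(e n)^2 <= (n * C * 2^-n)^2 <= C^2, so the energy still grows by a
    bounded amount at each step ([energy_step]). *)

Lemma dualBE (R : realType) (E : normedModType R) (f g : dual E) (x : E) :
  (f - g) x = f x - g x.
Proof. by []. Qed.

Lemma dual_norm_bound (R : realType) (E : normedModType R) (h : dual E)
    (x : E) :
  `|h x| <= `|h| * `|x|.
Proof.
have [->|x0] := eqVneq x 0; first by rewrite linear0 !normr0 mulr0.
have x_gt0 : 0 < `|x| by rewrite normr_gt0.
rewrite -ler_pdivrMr// mulrC.
have -> : `|x|^-1 * `|h x| = `|h (`|x|^-1 *: x)|.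
  by rewrite linearZ normrM normfV normr_id.
rewrite dual_normE; apply: ler_dual_norm.
by rewrite normrZ normfV normr_id mulVf// gt_eqF.
Qed.

(** The set {g | r <= g x} is convex and weak* closed, so if it contained F it
    would contain f. *)
Lemma exists_lt_weak_star_closure (R : realType) (E : normedModType R)
    (F : set (dual E)) (f : dual E) (x : E) (r : R) :
  weak_star_closure (convex_hull F) f -> f x < r -> exists2 g, F g & g x < r.
Proof.
move=> clf fxr; apply: contrapT => noF.
have hull_ge : convex_hull F `<=` [set g | r <= g x].
  apply: smallest_sub => [g h t|g Fg /=]; last first.
    by rewrite leNgt; apply/negP => gr; apply: noF; exists g.
  rewrite !inE /= => gr hr.
  change (r <= t%:num * (g : dual E) x + (1 - t%:num) * (h : dual E) x).
  have p0 : 0 <= t%:num by [].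
  have p1 : t%:num <= 1 by [].
  move: p0 p1; set p := t%:num => p0 p1; nra.
have evx := (weak_star_cvgP f (nbhs_filter (f : weak_star E))).1
  (fun A fA => fA) x.
have /clf[g [/hull_ge /= rg gr]] :
    nbhs (f : weak_star E) [set g : dual E | g x < r].
  exact: (evx [set y | y < r] (lt_nbhsl fxr)).
by move: gr; rewrite ltNge rg.
Qed.

(** A norm-bounded sequence of functionals is equi-Lipschitz, hence pointwise
    convergence on a dense set propagates to the whole space. *)
Lemma weak_star_cvg_dense (R : realType) (E : normedModType R)
    (D : set E) (u : nat -> dual E) (f : dual E) (C : R) :
  dense D -> (forall n, `|u n| <= C) ->
  (forall x, D x -> (u n x : R^o) @[n --> \oo] --> (f x : R^o)) ->
  weak_star_cvg u f.
Proof.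
move=> dD uC cD; apply/weak_star_cvgP => x; apply/cvgrPdist_lt => e e0.
(* K bounds all the norms `|f - u n|; adding 1 makes it positive. *)
pose K := C + `|f| + 1.
have K0 : 0 < K.
  by rewrite /K ltr_wpDl// addr_ge0// (le_trans _ (uC 0%N)).
have [y [xy Dy]] : ball x (e / 2 / K) `&` D !=set0.
  apply: dD; last exact: ball_open.
  by exists x; apply: ballxx; rewrite !divr_gt0.
have /cvgrPdist_lt/(_ (e / 2)) := cD _ Dy.
rewrite divr_gt0// => /(_ isT); apply: filterS => n.
rewrite /= => yn.
have -> : f x - u n x = (f y - u n y) + (f - u n : dual E) (x - y).
  by rewrite dualBE !linearB/=; lra.
rewrite (le_lt_trans (ler_normD _ _))// [e in _ < e]splitr ltrD//.
rewrite (le_lt_trans (dual_norm_bound _ _ _ _))//.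
move: xy; rewrite -ball_normE /= => xy.
have fu : `|f - u n| <= K.
  have := uC n; have := ler_normB f (u n); rewrite /K; lra.
rewrite (le_lt_trans (ler_wpM2r _ fu))//.
by rewrite mulrC -ltr_pdivlMr.
Qed.

Lemma sum_geometric_quarter_le (R : realType) (n : nat) :
  \sum_(k < n) ((2^-1 : R) ^+ k) ^+ 2 <= 2.
Proof.
(* Adding twice the next term makes the bound inductive: 1 + 2 / 4 <= 2. *)
suff : \sum_(k < n) ((2^-1 : R) ^+ k) ^+ 2 + 2 * (2^-1 ^+ n) ^+ 2 <= 2.
  by have := sqr_ge0 ((2^-1 : R) ^+ n); lra.
elim: n => [|n IH]; first by rewrite big_ord0 expr0 expr1n; lra.
rewrite big_ord_recr/= (exprS _ n) exprMn.
have := sqr_ge0 ((2^-1 : R) ^+ n); move: IH.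
by set s := \sum_(k < n) _; set a := (_ ^+ n) ^+ 2; lra.
Qed.

Definition energy {R : realType} {E : normedModType R} (e : nat -> E) (n : nat)
    (S : dual E) : R :=
  \sum_(k < n) S (e k) ^+ 2.

(** The vector of E that represents the bilinear form of [energy] with S as one
    argument: evaluating d at it gives the sum of the S (e k) * d (e k). *)
Definition pairing_vector {R : realType} {E : normedModType R} (e : nat -> E)
    (n : nat) (S : dual E) : E :=
  \sum_(k < n) S (e k) *: e k.

Lemma energyD (R : realType) (E : normedModType R) (e : nat -> E) (n : nat)
    (S d : dual E) :
  energy e n (S + d) = energy e n S + 2 * d (pairing_vector e n S) + energy e n d.
Proof.
rewrite /energy /pairing_vector linear_sum mulr_sumr -!big_split.
apply: eq_bigr => k _; rewrite dualDE linearZ.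
change ((S (e k) + d (e k)) ^+ 2 =
  S (e k) ^+ 2 + 2 * (S (e k) * d (e k)) + d (e k) ^+ 2 :> R).
by ring.
Qed.

(** The term 2 accounts for the cross term; of 3 * C ^+ 2, two thirds bound the
    energy of d through the geometric series, and one third bounds the
    new coordinate S (e n), thanks to n <= 2 ^ n. *)
Lemma energy_step (R : realType) (E : normedModType R) (e : nat -> E) (n : nat)
    (S d : dual E) (C : R) :
  (forall k, `|e k| <= 2^-1 ^+ k) -> `|d| <= C -> `|S| <= n%:R * C ->
  d (pairing_vector e n.+1 S) <= 1 ->
  energy e n.+1 (S + d) <= energy e n S + (2 + 3 * C ^+ 2).
Proof.
move=> eb dC SC dv.
have C0 : 0 <= C by exact: le_trans dC.
have Ed : energy e n.+1 d <= 2 * C ^+ 2.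
  rewrite [leRHS]mulrC (le_trans _ (ler_wpM2l _ (sum_geometric_quarter_le R n.+1)))//.
    rewrite mulr_sumr; apply: ler_sum => k _.
    rewrite -exprMn -real_normK ?num_real// lerXn2r ?nnegrE ?mulr_ge0 ?exprn_ge0//.
    by rewrite (le_trans (dual_norm_bound _ _ _ _))// ler_pM.
  exact: sqr_ge0.
have ES : S (e n) ^+ 2 <= C ^+ 2.
  rewrite -real_normK ?num_real// lerXn2r ?nnegrE//.
  rewrite (le_trans (dual_norm_bound _ _ _ _))//.
  rewrite (le_trans (ler_pM _ _ SC (eb n)))//.
  rewrite mulrAC exprVn ler_piMl// ler_pdivrMr ?exprn_gt0// mul1r.
  by rewrite -natrX ler_nat ltnW// ltn_expl.
rewrite energyD [in X in X + _ + _]/energy big_ord_recr/= -/(energy e n S).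
lra.
Qed.

(** Each coordinate with k < n is dominated by the energy, so the square of
    S n (e k) / n is at most K / n. *)
Lemma cvg_mean0_of_energy (R : realType) (E : normedModType R) (e : nat -> E)
    (S : nat -> dual E) (K : R) (k : nat) :
  (forall n, energy e n (S n) <= n%:R * K) ->
  ((n%:R^-1 * S n (e k) : R) : R^o) @[n --> \oo] --> (0 : R^o).
Proof.
move=> SK; apply/cvgrPdist_lt => d d0.
near=> n.
have n0 : 0 < n%:R :> R by rewrite ltr0n; near: n; exists 1%N.
have kn : (k < n)%N by near: n; exists k.+1.
have Kn : K < d ^+ 2 * n%:R.
  rewrite mulrC -ltr_pdivrMr ?exprn_gt0//; near: n; exact: nbhs_infty_gtr.
have : S n (e k) ^+ 2 <= n%:R * K.
  apply: le_trans (SK n); rewrite /energy (bigD1 (Ordinal kn))//= lerDl.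
  by apply: sumr_ge0 => i _; exact: sqr_ge0.
move=> Sk.
rewrite sub0r normrN -(ltr_pXn2r (n := 2))// ?nnegrE ?ltW// real_normK ?num_real//.
rewrite exprMn exprVn mulrC ltr_pdivrMr ?exprn_gt0// (le_lt_trans Sk)//.
by rewrite expr2 mulrCA ltr_pM2l.
Unshelve. all: by end_near. Qed.

Lemma dense_sequence (R : realType) (E : normedModType R) :
  separable_space E -> exists x : nat -> E, dense (range x).
Proof.
move=> [D cD dD].
have [D0|[x]] := pfcard_geP cD.
  have [y [_]] : [set: E] `&` D !=set0 by apply: dD; [exists 0|exact: openT].
  by rewrite D0.
exists x => // O O0 oO; have [y [Oy Dy]] := dD _ O0 oO.
exists y; split => //.
by have [n _ <-] := @surj _ _ _ _ x y Dy; exists n.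
Qed.

Theorem proposition4 (R : realType) (E : completeNormedModType R)
    (F : set (dual E)) (f : dual E) :
  separable_space E ->
  bounded_set F ->
  weak_star_closure (convex_hull F) f ->
  exists f_ : nat -> dual E,
    (forall n : nat, (1 <= n)%N -> F (f_ n)) /\
    weak_star_cvg (fun N => N%:R^-1 *: \sum_(1 <= n < N.+1) f_ n) f.
Proof.
move=> /dense_sequence[x dx] /pinfty_ex_gt0[M M0 FM] clf.
(* The 1 in the denominator keeps it nonzero when x k = 0. *)
pose e k : E := (2^-1 ^+ k / (1 + `|x k|)) *: x k.
have x1 k : 0 < 1 + `|x k| by rewrite ltr_wpDr.
have e_le k : `|e k| <= 2^-1 ^+ k.
  rewrite /e normrZ ger0_norm; last first.
    by rewrite divr_ge0 ?exprn_ge0 ?ltW.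
  by rewrite -mulrA ler_piMr ?exprn_ge0// mulrC ler_pdivrMr// mul1r lerDr.
pose C := M + `|f|.
(* One greedy step for every stage n and every possible partial sum S. *)
have /choice[g gP] (nS : nat * dual E) : exists g : dual E,
    F g /\ (g - f : dual E) (pairing_vector e nS.1.+1 nS.2) <= 1.
  set v := pairing_vector _ _ _.
  have [|g Fg gv] := @exists_lt_weak_star_closure _ _ _ _ v (f v + 1) clf.
    by rewrite ltrDl.
  by exists g; split => //; rewrite dualBE; lra.
pose S := fix S n := if n is m.+1 then S m + (g (m, S m) - f) else 0.
(* S m.+1 - S m = h m.+1 - f; the value h 0 is a filler. *)
pose h n := g (n.-1, S n.-1).
have Fh n : F (h n) by have [] := gP (n.-1, S n.-1).
have hM n : `|h n| <= M by exact: FM.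
have SE N : S N = \sum_(1 <= n < N.+1) h n - N%:R *: f.
  elim: N => [|N IH]; first by rewrite big_geq// scale0r subr0.
  rewrite big_nat_recr//= {1}IH -natr1 scalerDl scale1r opprD.
  by rewrite addrACA.
have hfC n : `|h n - f| <= C by rewrite (le_trans (ler_normB _ _))// lerD.
have SC n : `|S n| <= n%:R * C.
  elim: n => [|n IH]; first by rewrite normr0 mul0r.
  by rewrite -natr1 mulrDl mul1r (le_trans (ler_normD _ _))// lerD// (hfC n.+1).
have energyS n : energy e n (S n) <= n%:R * (2 + 3 * C ^+ 2).
  elim: n => [|n IH]; first by rewrite /energy big_ord0 mul0r.
  rewrite -natr1 mulrDl mul1r (le_trans _ (lerD IH (lexx _)))//.
  by apply: energy_step => //; [exact: (hfC n.+1)|have [] := gP (n, S n)].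
exists h; split=> [n _|]; first exact: Fh.
apply: (weak_star_cvg_dense _ _ _ _ _ M dx) => [N|_ [k _ <-]].
  rewrite normrZ normfV normr_nat.
  have [->|N0] := posnP N; first by rewrite invr0 mul0r ltW.
  rewrite ler_pdivrMl ?ltr0n// (le_trans (ler_norm_sum _ _ _))//.
  rewrite (le_trans (ler_sum _ (fun n _ => hM n)))//.
  by rewrite sumr_const_nat subSS subn0 mulr_natl.
(* c undoes the scaling from x k to e k. *)
pose c := (1 + `|x k|) * 2 ^+ k.
have := cvg_mean0_of_energy _ _ e S _ k energyS.
move=> /(cvgMr (a := c)); rewrite mulr0 => mean0.
apply/subr_cvg0; apply: cvg_trans mean0; apply: near_eq_cvg.
near=> N.
have N0 : N%:R != 0 :> R by rewrite pnatr_eq0 -lt0n; near: N; exists 1%N.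
have k0 : 2 ^+ k != 0 :> R by rewrite expf_neq0.
have n1 : 1 + `|x k| != 0 by rewrite gt_eqF.
rewrite /= linearZ /= SE dualBE dualZE exprVn /c.
set s := \sum_(1 <= n < N.+1) h n.
change ((1 + `|x k|) * 2 ^+ k *
  (N%:R^-1 * (2 ^- k / (1 + `|x k|) * (s (x k) - N%:R * f (x k)))) =
  N%:R^-1 * s (x k) - f (x k) :> R).
by field; rewrite N0 k0 n1.
Unshelve. all: by end_near. Qed.
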